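(* Let $k\ge 0$ be an integer, let $p=2k+2$, and let $d$ be a positive integer. Consider the uniformly spaced grid with $p$ columns and $p$ rows and spacing $d$ between consecutive rows and columns, translated to be symmetric about both axes, so that its columns have $x$-coordinates $C'_i=(i-k-1/2)d$ and its rows have $y$-coordinates $R'_i=(i-k-1/2)d$ for $0\le i\le p-1$. For an integer $e$ with $0\le e\le k$ put $$Q_e=\{0,\ \underbrace{\pm d,\pm 2d,\ldots,\pm ed}_{2e\text{ elements}},\ \underbrace{\pm(e+2)d,\pm(e+4)d,\ldots,\pm(2k-e)d}_{2(k-e)\text{ elements}}\}.$$ A set of $2k+1$ sum diagonals $S=\{S_i\}_{i=0}^{2k}$ and $2k+1$ difference diagonals $D=\{D_i\}_{i=0}^{2k}$ (each diagonal being identified with the constant sum, respectively difference, of the coordinates of its cells) is a perfect diagonal cover of this grid if and only if $S=D=Q_e$ for some integer $e$ with $0\le e\le k$.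
   Context: The grid is the set of cells $G=\{(C'_i,R'_j): 0\le i,j\le p-1\}$, where the coordinates are those of a chessboard with integer-coordinate cells, translated so that the grid is symmetric about both axes (so after translation the quantities $x+y$ and $x-y$ still take integer values on board cells). The sum diagonal identified with the number $s$ is the set of cells $(x,y)$ with $x+y=s$; the difference diagonal identified with the number $\delta$ is the set of cells $(x,y)$ with $x-y=\delta$. A perfect diagonal cover of a spaced grid with $m'$ rows and $n'$ columns is a set of exactly $(m'+n'-2)/2$ (distinct) sum diagonals and exactly $(m'+n'-2)/2$ (distinct) difference diagonals such that every cell of the grid lies on at least one of them. Here $m'=n'=p=2k+2$, so there are $2k+1$ diagonals of each kind. *)

(* Defs.v *)
From HB Require Import structures.
From mathcomp Require Import all_boot all_order all_algebra finmap.

Set Implicit Arguments.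
Unset Strict Implicit.
Unset Printing Implicit Defensive.

Import Order.TTheory GRing.Theory Num.Theory.
Local Open Scope fset_scope.
Local Open Scope ring_scope.

(* A cell is the pair (x, y) of its column and row coordinates.  After the     *)
(* translation x and y may be half-integers, but x + y and x - y are integers  *)
(* on board cells, so diagonals are identified with elements of int.           *)
Definition cell : Type := (rat * rat)%type.

Definition on_sum_diagonal (s : int) (c : cell) : bool := c.1 + c.2 == s%:~R.

Definition on_diff_diagonal (t : int) (c : cell) : bool := c.1 - c.2 == t%:~R.

(* The spaced grid is given by the finite sets C and R of its column and row   *)
(* coordinates.  The cardinalities are compared in rat so that the division by *)
(* 2 and the subtraction are exact.                                            *)
Definition perfect_diagonal_cover (C R : {fset rat}) (S D : {fset int}) : Prop :=
  [/\ #|` S |%:R = (#|` R |%:R + #|` C |%:R - 2) / 2 :> rat,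
      #|` D |%:R = (#|` R |%:R + #|` C |%:R - 2) / 2 :> rat &
      forall c : cell, c \in C `*` R ->
        (exists2 s, s \in S & on_sum_diagonal s c) \/
        (exists2 t, t \in D & on_diff_diagonal t c)].

(* The p = 2k + 2 coordinates (i - k - 1/2) d, for 0 <= i <= p - 1. *)
Definition centered_coords (k d : nat) : {fset rat} :=
  [fset (i%:R - k%:R - 1 / 2) * d%:R | i in iota 0 (2 * k + 2)].

(* In the last part the multiples are e + 2j with 1 <= j <= k - e, that is     *)
(* e + 2, e + 4, ..., 2k - e.                                                  *)
Definition Qset (k d e : nat) : {fset int} :=
  [fset 0%:Z]
  `|` [fset (j * d)%:Z | j in iota 1 e]
  `|` [fset - (j * d)%:Z | j in iota 1 e]
  `|` [fset ((e + 2 * j) * d)%:Z | j in iota 1 (k - e)]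
  `|` [fset - ((e + 2 * j) * d)%:Z | j in iota 1 (k - e)].

(* Main.v *)
Require Import Defs.
From HB Require Import structures.
From mathcomp Require Import all_boot all_order all_algebra finmap.
From mathcomp Require Import zify ring.

Set Implicit Arguments.
Unset Strict Implicit.
Unset Printing Implicit Defensive.

Import Order.TTheory GRing.Theory Num.Theory.
Local Open Scope fset_scope.
Local Open Scope ring_scope.

(** In units of [d], the cell (i, j) lies on the sum diagonal
    a = i + j - (2k + 1) and on the difference diagonal b = i - j, and the cells
    are exactly the integer points (a, b) of the diamond |a| + |b| <= 2k + 1
    with a + b odd ([cells_covered_iff]).  The statement is therefore about sets
    S, D of integers such that every such point has a in S or b in D.

    Call P_n = {1 - n, 3 - n, ..., n - 1} the centered progression with n terms:
    it consists of the a with |a| < n and a + n odd.  All sets of the theorem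
    have the form P_s U P_t with s + t = 2k + 1, since Q_e = P_e U P_(2k+1-e)
    ([Qset_centered_progressions]).  Such a set covers the diamond
    ([diamond_cover_progressions]): with S = D = P_s U P_t, an uncovered point
    has |a| >= s + 1 and |b| >= t + 1, or the reverse, by parity, and so lies
    outside.

    Conversely ([diamond_cover_rigid]), let P_s and P_t be the longest centered
    progressions of odd and of even length inside S, and P_u, P_v those inside D.  By
    maximality some a with |a| = s + 1 is not in S and some b with |b| = v + 1
    is not in D, so (a, b) is outside the diamond and s + v >= 2k + 1; in the
    same way t + u >= 2k + 1.  But P_s and P_t are disjoint, so
    s + t <= |S| = 2k + 1, and likewise u + v <= 2k + 1.  Hence all these are
    equalities, u = s and v = t, and by cardinality S = P_s U P_t = D. *)

(** * Centered arithmetic progressions *)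

Definition centered_progression (d n : nat) : {fset int} :=
  [fset ((2 * i + 1)%:Z - n%:Z) * d%:Z | i in iota 0 n].

Lemma centered_progressionP (d n : nat) (x : int) :
  reflect (exists a : int, [/\ x = a * d%:Z, (`|a| < n)%N & odd (`|a| + n)])
          (x \in centered_progression d n).
Proof.
apply: (iffP (imfsetP _ _ _ _)) => /= [[i]|[a [-> lt_an odd_an]]].
  rewrite mem_iota add0n => /andP[_ lt_in] ->.
  by exists ((2 * i + 1)%:Z - n%:Z); split=> //; lia.
exists (`|(a + n%:Z - 1)%R|./2)%N; first by rewrite mem_iota; lia.
by congr (_ * _); lia.
Qed.

Lemma mem_centered_progression (d n : nat) (a : int) : (0 < d)%N ->
  (a * d%:Z \in centered_progression d n) = (`|a| < n)%N && odd (`|a| + n).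
Proof.
move=> d_gt0; apply/centered_progressionP/andP=> [[b [eq_ab lt_bn odd_bn]]|[]].
  have d_neq0 : d%:Z != 0 by lia.
  by rewrite (mulIf d_neq0 eq_ab).
by move=> lt_an odd_an; exists a.
Qed.

Lemma card_centered_progression (d n : nat) : (0 < d)%N ->
  #|` centered_progression d n| = n.
Proof.
move=> d_gt0; rewrite card_imfset /=; last first.
  move=> i j; have d_neq0 : d%:Z != 0 by lia.
  by move/(mulIf d_neq0); lia.
by rewrite undup_id ?iota_uniq // size_iota.
Qed.

(** The two progressions are disjoint, because their coefficients have opposite
    parities. *)
Lemma card_centered_progressionU (d s t : nat) : (0 < d)%N -> odd (s + t) ->
  #|` centered_progression d s `|` centered_progression d t| = (s + t)%N.
Proof.
move=> d_gt0 odd_st.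
have := cardfsUI (centered_progression d s) (centered_progression d t).
rewrite !card_centered_progression // => <-.
suff -> : centered_progression d s `&` centered_progression d t = fset0.
  by rewrite cardfs0 addn0.
apply/fsetP=> x; rewrite in_fsetI in_fset0; apply/negP=> /andP[].
case/centered_progressionP=> a [-> lt_as odd_as].
by rewrite mem_centered_progression //; lia.
Qed.

(** The elements a d of Q_e with a - e odd are those of the block |a| <= e; the
    elements with a - e even come from that block and from the outer terms
    e + 2, ..., 2k - e and their opposites, which together run through all |a| <= 2k - e of that
    parity. *)
Lemma Qset_centered_progressions (k d e : nat) : (e <= k)%N ->
  Qset k d e =
  centered_progression d e `|` centered_progression d (2 * k + 1 - e).
Proof.
move=> le_ek; apply/fsetP=> x; rewrite /Qset !in_fsetU; apply/idP/idP.
- have memP a : x = a * d%:Z ->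
      (`|a| <= e)%N \/ (`|a| <= 2 * k - e)%N && ~~ odd (`|a| + e) ->
      (x \in centered_progression d e)
      || (x \in centered_progression d (2 * k + 1 - e)).
    move=> -> Ha; case odd_ae: (odd (`|a| + e)); apply/orP; [left|right];
      by apply/centered_progressionP; exists a; split=> //; lia.
  case/orP=> [/orP[/orP[/orP[|]|]|]|].
  + by rewrite in_fset1 => /eqP x0; apply: (memP 0); [rewrite x0 mul0r|left].
  + case/imfsetP=> j /=; rewrite mem_iota => Hj eq_x.
    by apply: (memP j%:Z); [rewrite eq_x PoszM|lia].
  + case/imfsetP=> j /=; rewrite mem_iota => Hj eq_x.
    by apply: (memP (- j%:Z)); [rewrite eq_x PoszM mulNr|lia].
  + case/imfsetP=> j /=; rewrite mem_iota => Hj eq_x.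
    by apply: (memP (e + 2 * j)%N%:Z); [rewrite eq_x PoszM|lia].
  + case/imfsetP=> j /=; rewrite mem_iota => Hj eq_x.
    by apply: (memP (- (e + 2 * j)%N%:Z)); [rewrite eq_x PoszM mulNr|lia].
- move=> mem_x; have [a eq_x Ha] : exists2 a, x = a * d%:Z &
      (`|a| <= e)%N \/ (`|a| <= 2 * k - e)%N && ~~ odd (`|a| + e).
    by case/orP: mem_x => /centered_progressionP[a [eq_x lt_a odd_a]];
      exists a => //; lia.
  (* The five parts of Q_e correspond to a = 0 and to the four combinations of *)
  (* the sign of a with |a| <= e or |a| > e. *)
  have [le_ae|lt_ea] := leqP `|a| e.
    have [a0|a_neq0] := eqVneq a 0.
      by rewrite eq_x a0 mul0r in_fset1 eqxx.
    have [a_ge0|a_lt0] := leP 0 a.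
      suff -> : x \in [fset (j * d)%:Z | j in iota 1 e] by rewrite !orbT.
      apply/imfsetP; exists `|a|%N => /=; first by rewrite mem_iota; lia.
      by rewrite eq_x PoszM; congr (_ * _); lia.
    suff -> : x \in [fset - (j * d)%:Z | j in iota 1 e] by rewrite !orbT.
    apply/imfsetP; exists `|a|%N => /=; first by rewrite mem_iota; lia.
    by rewrite eq_x PoszM -mulNr; congr (_ * _); lia.
  have [a_ge0|a_lt0] := leP 0 a.
    suff -> : x \in [fset ((e + 2 * j) * d)%:Z | j in iota 1 (k - e)].
      by rewrite !orbT.
    apply/imfsetP; exists ((`|a| - e)./2)%N => /=; first by rewrite mem_iota; lia.
    by rewrite eq_x PoszM; congr (_ * _); lia.
  suff -> : x \in [fset - ((e + 2 * j) * d)%:Z | j in iota 1 (k - e)].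
    by rewrite !orbT.
  apply/imfsetP; exists ((`|a| - e)./2)%N => /=; first by rewrite mem_iota; lia.
  by rewrite eq_x PoszM -mulNr; congr (_ * _); lia.
Qed.

(** * The grid as a diamond of diagonals *)

Definition diamond_cover (k d : nat) (S D : {fset int}) : Prop :=
  forall a b : int, (`|a| + `|b| <= 2 * k + 1)%N -> odd (`|a| + `|b|) ->
    a * d%:Z \in S \/ b * d%:Z \in D.

Lemma diamond_cover_sym (k d : nat) (S D : {fset int}) :
  diamond_cover k d S D -> diamond_cover k d D S.
Proof.
by move=> cover a b le_ab odd_ab; apply/or_comm/cover; rewrite addnC.
Qed.

Lemma on_sum_diagonal_centered (k d i j : nat) (s : int) :
  on_sum_diagonal s ((i%:R - k%:R - 1 / 2) * d%:R, (j%:R - k%:R - 1 / 2) * d%:R)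
  = (s == (i%:Z + j%:Z - 2 * k%:Z - 1) * d%:Z).
Proof.
rewrite /on_sum_diagonal /= eq_sym -(inj_eq (@intr_inj rat)).
congr (_ == _); rewrite rmorphM !rmorphB rmorphD rmorphM /= -!pmulrn.
by field.
Qed.

Lemma on_diff_diagonal_centered (k d i j : nat) (t : int) :
  on_diff_diagonal t ((i%:R - k%:R - 1 / 2) * d%:R, (j%:R - k%:R - 1 / 2) * d%:R)
  = (t == (i%:Z - j%:Z) * d%:Z).
Proof.
rewrite /on_diff_diagonal /= eq_sym -(inj_eq (@intr_inj rat)).
congr (_ == _); rewrite rmorphM rmorphB /= -!pmulrn.
by field.
Qed.

(** A point (a, b) of the diamond comes from the cell with
    i = (a + b + 2k + 1) / 2 and j = (a - b + 2k + 1) / 2; both are integers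
    because a + b is odd, and the diamond inequality puts them in [0, 2k + 1]. *)
Lemma cells_covered_iff (k d : nat) (S D : {fset int}) :
  (forall c : cell, c \in centered_coords k d `*` centered_coords k d ->
     (exists2 s, s \in S & on_sum_diagonal s c) \/
     (exists2 t, t \in D & on_diff_diagonal t c)) <->
  diamond_cover k d S D.
Proof.
split=> [cover a b le_ab odd_ab|cover [x y]].
  pose i := (`|(a + b + 2 * k%:Z + 1)%R|./2)%N.
  pose j := (`|(a - b + 2 * k%:Z + 1)%R|./2)%N.
  have [|[s sS]|[t tD]] := cover ((i%:R - k%:R - 1 / 2) * d%:R,
                                   (j%:R - k%:R - 1 / 2) * d%:R).
  - rewrite in_fsetM; apply/andP; split; apply/imfsetP.
      by exists i => //=; rewrite mem_iota; lia.
    by exists j => //=; rewrite mem_iota; lia.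
  - rewrite on_sum_diagonal_centered => /eqP eq_s; left.
    suff -> : a * d%:Z = s by [].
    by rewrite eq_s; congr (_ * _); lia.
  - rewrite on_diff_diagonal_centered => /eqP eq_t; right.
    suff -> : b * d%:Z = t by [].
    by rewrite eq_t; congr (_ * _); lia.
rewrite in_fsetM /= => /andP[/imfsetP[i /= Hi ->] /imfsetP[j /= Hj ->]].
move: Hi Hj; rewrite !mem_iota => Hi Hj.
have [||aS|bD] := cover (i%:Z + j%:Z - 2 * k%:Z - 1) (i%:Z - j%:Z); try lia.
  by left; eexists; [exact: aS|rewrite on_sum_diagonal_centered].
by right; eexists; [exact: bD|rewrite on_diff_diagonal_centered].
Qed.

Lemma card_centered_coords (k d : nat) : (0 < d)%N ->
  #|` centered_coords k d| = (2 * k + 2)%N.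
Proof.
move=> d_gt0; rewrite card_imfset /=; last first.
  move=> i j; have d_neq0 : d%:R != 0 :> rat by rewrite pnatr_eq0 -lt0n.
  by move=> /(mulIf d_neq0)/addIr/addIr/eqP; rewrite eqr_nat => /eqP.
by rewrite undup_id ?iota_uniq // size_iota.
Qed.

Lemma perfect_diagonal_coverE (k d : nat) (S D : {fset int}) : (0 < d)%N ->
  #|` S| = (2 * k + 1)%N -> #|` D| = (2 * k + 1)%N ->
  perfect_diagonal_cover (centered_coords k d) (centered_coords k d) S D <->
  diamond_cover k d S D.
Proof.
move=> d_gt0 cardS cardD; rewrite -cells_covered_iff.
have half_cards : (2 * k + 1)%:R =
    ((2 * k + 2)%:R + (2 * k + 2)%:R - 2) / 2 :> rat.
  by rewrite !mul2n -!addnn !natrD; field.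
rewrite /perfect_diagonal_cover card_centered_coords // cardS cardD.
by split=> [[]|].
Qed.

(** * Classification of the covers *)

Lemma diamond_cover_progressions (k d s t : nat) : (0 < d)%N ->
  (s + t = 2 * k + 1)%N ->
  diamond_cover k d (centered_progression d s `|` centered_progression d t)
                    (centered_progression d s `|` centered_progression d t).
Proof.
move=> d_gt0 st a b le_ab odd_ab; rewrite !in_fsetU !mem_centered_progression //.
by lia.
Qed.

(** If the central diagonal is missing from S, then D has to contain all 2k + 2
    odd b with |b| <= 2k + 1.  This makes the one-term progression available as the
    starting point of the search for the longest one of odd length inside S. *)
Lemma zero_in_cover (k d : nat) (S D : {fset int}) : (0 < d)%N ->
  (#|` D| <= 2 * k + 1)%N -> diamond_cover k d S D -> 0 \in S.
Proof.
move=> d_gt0 cardD cover; apply: contraTT cardD => notS0; rewrite -ltnNge.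
rewrite (@leq_trans #|` centered_progression d (2 * k + 2)|) //.
  by rewrite card_centered_progression //; lia.
apply/fsubset_leq_card/fsubsetP=> x /centered_progressionP[b [-> lt_b odd_b]].
by case: (cover 0 b); rewrite ?mul0r ?(negPf notS0) //; lia.
Qed.

(** Passing from n to n + 2 terms adds only the two end points with coefficients
    n + 1 and - (n + 1), so maximality leaves one of them outside S. *)
Lemma maximal_progression (d : nat) (S : {fset int}) (r : nat) : (0 < d)%N ->
  centered_progression d r `<=` S ->
  exists n, [/\ odd n = odd r, centered_progression d n `<=` S &
    exists2 a : int, a * d%:Z \notin S & `|a|%N = n.+1].
Proof.
move=> d_gt0 sub_r.
pose P n := (odd n == odd r) && (centered_progression d n `<=` S).
have exP : exists n, P n by exists r; rewrite /P eqxx.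
have boundP n : P n -> (n <= #|` S|)%N.
  by case/andP=> _ /fsubset_leq_card; rewrite card_centered_progression.
case: (ex_maxnP exP boundP) => n /andP[/eqP odd_n sub_n] max_n.
exists n; split=> //.
have : ~~ (centered_progression d n.+2 `<=` S).
  apply/negP=> sub_n2; have := max_n n.+2.
  by rewrite /P sub_n2 /= negbK odd_n eqxx => /(_ isT); lia.
case/fsubsetPn=> _ /centered_progressionP[a [-> lt_a odd_a]] notSa.
exists a => //.
have : a * d%:Z \notin centered_progression d n.
  by apply: contra notSa; apply: fsubsetP.
by rewrite mem_centered_progression //; lia.
Qed.

Lemma two_maximal_progressions (d : nat) (S : {fset int}) : (0 < d)%N ->
  0 \in S ->
  exists s t, [/\ odd s /\ ~~ odd t,
    centered_progression d s `|` centered_progression d t `<=` S,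
    exists2 a : int, a * d%:Z \notin S & `|a|%N = s.+1 &
    exists2 a : int, a * d%:Z \notin S & `|a|%N = t.+1].
Proof.
move=> d_gt0 S0.
have [|s [odd_s sub_s gap_s]] := @maximal_progression d S 1 d_gt0.
  apply/fsubsetP=> _ /centered_progressionP[a [-> lt_a _]].
  by have -> : a = 0 by lia; rewrite mul0r.
have [|t [odd_t sub_t gap_t]] := @maximal_progression d S 0 d_gt0.
  by apply/fsubsetP=> _ /centered_progressionP[a [_ //]].
exists s, t; split=> //; first by rewrite odd_s odd_t.
by rewrite fsubUset sub_s.
Qed.

(** The missing end points of S and D bound the lengths of the progressions from
    below, the cardinalities bound them from above, and the bounds meet. *)
Lemma diamond_cover_rigid (k d : nat) (S D : {fset int}) : (0 < d)%N ->
  #|` S| = (2 * k + 1)%N -> #|` D| = (2 * k + 1)%N -> diamond_cover k d S D ->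
  exists s t, [/\ (s + t = 2 * k + 1)%N,
    S = centered_progression d s `|` centered_progression d t &
    D = centered_progression d s `|` centered_progression d t].
Proof.
move=> d_gt0 cardS cardD cover.
have S0 : 0 \in S by apply: zero_in_cover cover; rewrite ?cardD.
have D0 : 0 \in D.
  by apply: zero_in_cover (diamond_cover_sym cover); rewrite ?cardS.
have [s [t [[odd_s odd_t] subS [a1 a1S a1E] [a2 a2S a2E]]]] :=
  two_maximal_progressions d_gt0 S0.
have [u [v [[odd_u odd_v] subD [b1 b1D b1E] [b2 b2D b2E]]]] :=
  two_maximal_progressions d_gt0 D0.
(* The parity forbids the value 2k + 2, hence the bound 2k + 3. *)
have gaps (a b : int) : a * d%:Z \notin S -> b * d%:Z \notin D ->
    odd (`|a| + `|b|) -> (2 * k + 3 <= `|a| + `|b|)%N.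
  move=> aS bD odd_ab; suff : (2 * k + 1 < `|a| + `|b|)%N.
    by move: odd_ab; clear; lia.
  rewrite ltnNge; apply/negP=> le_ab.
  by case: (cover a b le_ab odd_ab); apply/negP.
have le_sv : (2 * k + 1 <= s + v)%N.
  have := gaps _ _ a1S b2D; rewrite a1E b2E oddD !oddS odd_s (negPf odd_v).
  by move/(_ isT); clear; lia.
have le_tu : (2 * k + 1 <= t + u)%N.
  have := gaps _ _ a2S b1D; rewrite a2E b1E oddD !oddS odd_u (negPf odd_t).
  by move/(_ isT); clear; lia.
have card_st : #|` centered_progression d s `|` centered_progression d t|
    = (s + t)%N.
  by rewrite card_centered_progressionU // oddD odd_s (negPf odd_t).
have card_uv : #|` centered_progression d u `|` centered_progression d v|
    = (u + v)%N.
  by rewrite card_centered_progressionU // oddD odd_u (negPf odd_v).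
have := fsubset_leq_card subS; rewrite card_st cardS => le_st.
have := fsubset_leq_card subD; rewrite card_uv cardD => le_uv.
have [st eq_us eq_vt] : [/\ (s + t = 2 * k + 1)%N, u = s & v = t].
  by move: le_sv le_tu le_st le_uv; clear; split; lia.
move: subD; rewrite eq_us eq_vt => subD.
exists s, t; split=> //; apply/esym/eqP.
  by rewrite eqEfcard subS card_st cardS st leqnn.
by rewrite eqEfcard subD card_st cardD st leqnn.
Qed.

Theorem theorem5p12 (k d : nat) (d_gt0 : (0 < d)%N) (S D : {fset int})
    (cardS : #|` S | = (2 * k + 1)%N) (cardD : #|` D | = (2 * k + 1)%N) :
  perfect_diagonal_cover (centered_coords k d) (centered_coords k d) S D <->
  exists e : nat, [/\ (e <= k)%N, S = Qset k d e & D = Qset k d e].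
Proof.
rewrite perfect_diagonal_coverE //; split=> [cover|[e [le_ek -> ->]]].
  have [s [t [st -> ->]]] := diamond_cover_rigid d_gt0 cardS cardD cover.
  (* The parameter e is the smaller of the two lengths. *)
  have [le_sk|lt_ks] := leqP s k.
    exists s; rewrite Qset_centered_progressions //.
    by have -> : (2 * k + 1 - s = t)%N by lia.
  have le_tk : (t <= k)%N by lia.
  exists t; rewrite Qset_centered_progressions // fsetUC.
  by have -> : (2 * k + 1 - t = s)%N by lia.
rewrite Qset_centered_progressions //.
by apply: diamond_cover_progressions => //; lia.
Qed.
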